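(* Let $(X,G)$ be a symmetric $G$-complete $G$-metric space and let $T:X\to X$ be a mapping. Let $\alpha,\beta$ be nonnegative real numbers with $\alpha+\beta<1$, and suppose that $$G(Tx,Ty,Tz) \leq \alpha \left( \frac{\min\{G(y,Ty,Ty),G(z,Tz,Tz)\}\,[1+G(x,Tx,Tx)]}{1+G(x,y,z)} \right)+\beta\, G(x,y,z)$$ for all $x,y,z\in X$. Then $T$ has exactly one fixed point in $X$.
   Context: A $G$-metric space $(X,G)$ is a nonempty set $X$ with a function $G:X\times X\times X\to[0,\infty)$ satisfying: (G1) $G(x,y,z)=0$ if $x=y=z$; (G2) $G(x,x,y)>0$ whenever $x\neq y$; (G3) $G(x,x,y)\leq G(x,y,z)$ whenever $z\neq y$; (G4) $G$ is symmetric in all three variables (invariant under all permutations of its arguments); (G5) $G(x,y,z)\leq G(x,a,a)+G(a,y,z)$ for all $x,y,z,a\in X$. $(X,G)$ is symmetric if $G(x,y,y)=G(x,x,y)$ for all $x,y\in X$. A sequence $(x_n)$ in $X$ $G$-converges to $x\in X$ if $\lim_{n,m\to\infty}G(x,x_n,x_m)=0$ (equivalently, $\lim_{n\to\infty}G(x,x_n,x_n)=0$). A sequence $(x_n)$ is $G$-Cauchy if for each $\varepsilon>0$ there is $N\in\mathbb{N}$ with $G(x_n,x_m,x_m)<\varepsilon$ for all $m,n\geq N$. $(X,G)$ is $G$-complete if every $G$-Cauchy sequence in $X$ $G$-converges to an element of $X$. *)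

(* Defs.v *)
From mathcomp Require Import all_boot all_order all_algebra.
From mathcomp Require Import all_classical all_reals all_analysis.

Set Implicit Arguments.
Unset Strict Implicit.
Unset Printing Implicit Defensive.

Import Order.TTheory GRing.Theory Num.Theory.
Import numFieldNormedType.Exports.

Local Open Scope classical_set_scope.
Local Open Scope ring_scope.

Record is_gmetric (R : realType) (X : Type) (G : X -> X -> X -> R) : Prop :=
  IsGMetric {
    gmetric_inhabited : inhabited X ;
    gmetric_ge0 : forall x y z, 0 <= G x y z ;
    gmetric_eq0 : forall x y z, x = y -> y = z -> G x y z = 0 ;
    gmetric_gt0 : forall x y, x <> y -> 0 < G x x y ;
    gmetric_le : forall x y z, z <> y -> G x x y <= G x y z ;
    gmetric_perm : forall x y z,
      [/\ G x y z = G x z y, G x y z = G y x z, G x y z = G y z x,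
          G x y z = G z x y & G x y z = G z y x] ;
    gmetric_triangle : forall x y z a, G x y z <= G x a a + G a y z
  }.

Definition gsymmetric (R : realType) (X : Type) (G : X -> X -> X -> R) : Prop :=
  forall x y, G x y y = G x x y.

Definition gconverges (R : realType) (X : Type) (G : X -> X -> X -> R)
    (u : nat -> X) (x : X) : Prop :=
  G x (u nm.1) (u nm.2) @[nm --> (\oo, \oo)] --> (0 : R).

Definition gcauchy (R : realType) (X : Type) (G : X -> X -> X -> R)
    (u : nat -> X) : Prop :=
  forall e : R, 0 < e -> exists N : nat, forall m n : nat,
    (N <= m)%N -> (N <= n)%N -> G (u n) (u m) (u m) < e.

Definition gcomplete (R : realType) (X : Type) (G : X -> X -> X -> R) : Prop :=
  forall u : nat -> X, gcauchy G u -> exists x : X, gconverges G u x.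

(* Main.v *)
Require Import Defs.
From mathcomp Require Import all_boot all_order all_algebra.
From mathcomp Require Import all_classical all_reals all_analysis.
From mathcomp Require Import lra.
Import Order.TTheory GRing.Theory Num.Theory.
Import numFieldNormedType.Exports.
Local Open Scope classical_set_scope.
Local Open Scope ring_scope.

Set Implicit Arguments.
Unset Strict Implicit.
Unset Printing Implicit Defensive.

(** Since [G] is symmetric, [d x y = G x y y] is a metric.  Taking [y = z = T x]
in the hypothesis makes the rational factor collapse to [d (T x) (T (T x))],
so [(1 - alpha) * d (T x) (T (T x)) <= beta * d x (T x)] and Picard orbits are
Cauchy.  If [p] is the limit of an orbit [u], taking [x = p] and
[y = z = u n] shows that [u] also converges to [T p]. *)

Lemma gmetric_dist_sym (R : realType) (X : Type) (G : X -> X -> X -> R)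
  (hG : is_gmetric G) (hsym : gsymmetric G) (x y : X) : G x y y = G y x x.
Proof. by rewrite hsym; case: (gmetric_perm hG x x y). Qed.

Lemma gmetric_dist_eq0 (R : realType) (X : Type) (G : X -> X -> X -> R)
  (hG : is_gmetric G) (hsym : gsymmetric G) (x y : X) :
  G x y y <= 0 -> x = y.
Proof.
move=> le0; apply: contrapT => /(gmetric_gt0 hG).
by rewrite -hsym ltNge le0.
Qed.

(** Restricting the double limit to the diagonal turns it into convergence for the distance
    [G x y y]. *)
Lemma gconverges_dist (R : realType) (X : Type) (G : X -> X -> X -> R)
  (u : nat -> X) (x : X) (e : R) :
  gconverges G u x -> 0 < e ->
  exists N : nat, forall n, (N <= n)%N -> G x (u n) (u n) < e.
Proof.
move=> /cvgrPdist_lt ux e0; have [[A B] [[N _ NA] [M _ MB]] AB] := ux _ e0.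
exists (maxn N M) => n; rewrite geq_max => /andP[Nn Mn].
have := AB (n, n) (conj (NA _ Nn) (MB _ Mn)).
by rewrite /= sub0r normrN; apply: le_lt_trans; exact: ler_norm.
Qed.

Lemma geometric_lt_eventually (R : realType) (k c e : R) :
  0 <= k < 1 -> 0 < e -> exists N : nat, forall n, (N <= n)%N -> c * k ^+ n < e.
Proof.
move=> /andP[k0 k1] e0.
have /cvgrPdist_lt/(_ _ e0)[N _ HN] : geometric c k @ \oo --> (0 : R).
  by apply: cvg_geometric; rewrite ger0_norm.
exists N => n /HN; rewrite /= sub0r normrN.
by apply: le_lt_trans; exact: ler_norm.
Qed.

Lemma picard_displacement_le (R : realType) (X : Type) (G : X -> X -> X -> R)
  (T : X -> X) (k : R) :
  0 <= k -> (forall x, G (T x) (T (T x)) (T (T x)) <= k * G x (T x) (T x)) ->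
  forall x n, G (iter n T x) (T (iter n T x)) (T (iter n T x))
    <= G x (T x) (T x) * k ^+ n.
Proof.
move=> k0 hk x; elim=> [|n IHn]; first by rewrite expr0 mulr1.
apply: le_trans (hk _) _.
by rewrite exprS mulrCA; apply: ler_wpM2l.
Qed.

(* The potential [d x (T x) / (1 - k)] decreases along the orbit by at least
   the length of each step. *)
Lemma picard_dist_le (R : realType) (X : Type) (G : X -> X -> X -> R)
  (T : X -> X) (k : R) (hG : is_gmetric G) :
  k < 1 -> (forall x, G (T x) (T (T x)) (T (T x)) <= k * G x (T x) (T x)) ->
  forall x m, (1 - k) * G x (iter m T x) (iter m T x) <= G x (T x) (T x).
Proof.
move=> k1 hk x m; elim: m x => [|m IHm] x.
  by rewrite (gmetric_eq0 hG) // mulr0 (gmetric_ge0 hG).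
(* Peeling off the first step makes the rest an orbit of [T x], to which [IHm] applies;
   [(1 - k) + k = 1] then closes the bound. *)
rewrite iterSr.
have tri := gmetric_triangle hG x (iter m T (T x)) (iter m T (T x)) (T x).
have step := le_trans (IHm (T x)) (hk x).
have c0 : 0 <= 1 - k by lra.
have := ler_wpM2l c0 tri; lra.
Qed.

(** The tail of an orbit is the orbit of [iter n T x], so its spread is at most its first step, of
    order [k ^+ n], divided by [1 - k]. *)
Lemma picard_gcauchy (R : realType) (X : Type) (G : X -> X -> X -> R)
  (T : X -> X) (k : R) (hG : is_gmetric G) (hsym : gsymmetric G) :
  0 <= k < 1 ->
  (forall x, G (T x) (T (T x)) (T (T x)) <= k * G x (T x) (T x)) ->
  forall x, gcauchy G (fun n => iter n T x).
Proof.
move=> k01 hk x e e0; have /andP[k0 k1] := k01.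
have c0 : 0 < 1 - k by rewrite subr_gt0.
have [N HN] := geometric_lt_eventually (G x (T x) (T x)) k01 (mulr_gt0 c0 e0).
have main m n : (N <= n)%N -> (n <= m)%N ->
    G (iter n T x) (iter m T x) (iter m T x) < e.
  move=> Nn nm; rewrite -(ltr_pM2l c0); apply: le_lt_trans (HN n Nn).
  rewrite -(subnK nm) iterD.
  apply: le_trans (picard_dist_le hG k1 hk (iter n T x) (m - n)) _.
  exact: picard_displacement_le.
exists N => m n Nm Nn; case: (leqP n m) => [|/ltnW] nm; first exact: main.
by rewrite (gmetric_dist_sym hG hsym); exact: main.
Qed.

Theorem theorem2p4 (R : realType) (X : Type) (G : X -> X -> X -> R)
  (T : X -> X) (alpha beta : R)
  (hG : is_gmetric G) (hsym : gsymmetric G) (hcomplete : gcomplete G)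
  (halpha : 0 <= alpha) (hbeta : 0 <= beta) (hab : alpha + beta < 1)
  (hT : forall x y z : X,
    G (T x) (T y) (T z) <=
      alpha * (Num.min (G y (T y) (T y)) (G z (T z) (T z))
                 * (1 + G x (T x) (T x)) / (1 + G x y z))
      + beta * G x y z) :
  exists! x : X, T x = x.
Proof.
have hd x y : G (T x) (T y) (T y) <=
    alpha * (G y (T y) (T y) * (1 + G x (T x) (T x)) / (1 + G x y y))
    + beta * G x y y.
  by have := hT x y y; rewrite minxx.
have d0 x y : 0 <= G x y y by exact: gmetric_ge0 hG _ _ _.
have a1 : 0 < 1 - alpha by lra.
(* The ratio left after moving the [alpha] term to the left-hand side; [k < 1] amounts to
   [alpha + beta < 1]. *)
pose k := beta / (1 - alpha).
have k01 : 0 <= k < 1.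
  by rewrite divr_ge0 ?(ltW a1) //= ltr_pdivrMr // mul1r; lra.
have hk x : G (T x) (T (T x)) (T (T x)) <= k * G x (T x) (T x).
  rewrite /k mulrAC ler_pdivlMr //.
  have := hd x (T x); rewrite mulfK; last first.
    by rewrite gt_eqF // ltr_pwDl.
  lra.
have [x0] := gmetric_inhabited hG.
pose u n := iter n T x0.
have [p up] := hcomplete u (picard_gcauchy hG hsym k01 hk x0).
have fixp : T p = p.
  apply: (gmetric_dist_eq0 hG hsym); apply/ler_addgt0Pl => e e0.
  rewrite addr0; pose D := G p (T p) (T p).
  have D0 : 0 <= D by exact: d0.
  (* The final sum has a rational term below [f * (1 + D)] and two distances, from [p] to [u n] and
     to [T (u n)], each below [f]: in total [f * (3 + D) = e]. *)
  pose f := e / (3 + D).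
  have f0 : 0 < f by rewrite divr_gt0 //; lra.
  have fE : f * (3 + D) = e by rewrite divfK // gt_eqF //; lra.
  have [N HN] := gconverges_dist up f0.
  have [M HM] := geometric_lt_eventually (G x0 (T x0) (T x0)) k01 f0.
  pose n := maxn N M.
  have pn : G p (u n) (u n) < f by apply: HN; rewrite leq_maxl.
  have pn1 : G p (T (u n)) (T (u n)) < f.
    (* [T (u n)] is by computation the next orbit point [u n.+1]. *)
    by apply: (HN n.+1); rewrite leqW // leq_maxl.
  have dn : G (u n) (T (u n)) (T (u n)) < f.
    apply: le_lt_trans (HM n (leq_maxr _ _)).
    by apply: picard_displacement_le => //; case/andP: k01.
  have tri := gmetric_triangle hG (T p) p p (T (u n)).
  rewrite [G (T (u n)) p p](gmetric_dist_sym hG hsym) in tri.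
  have := hd p (u n); rewrite -/D.
  set q := _ / _ => hq.
  have q0 : 0 <= q.
    by rewrite divr_ge0 ?mulr_ge0 ?addr_ge0 ?d0.
  (* The displacement of [u n] is below [f], the factor [1 + D] does not depend on [n], and the
     denominator is at least 1. *)
  have qf : q <= f * (1 + D).
    rewrite /q ler_pdivrMr ?ltr_pwDl //.
    rewrite -[leLHS]mulr1; apply: ler_pM => //.
    - by rewrite mulr_ge0 ?addr_ge0 ?d0.
    - by rewrite ler_wpM2r ?addr_ge0 // ltW.
    - by rewrite lerDl d0.
  have aq : alpha * q <= q by rewrite ler_piMl //; lra.
  have bp : beta * G p (u n) (u n) <= G p (u n) (u n).
    by rewrite ler_piMl //; lra.
  lra.
exists p; split=> // y fixy; apply: (gmetric_dist_eq0 hG hsym).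
(* At two fixed points the rational term vanishes, leaving [G p y y <= beta * G p y y] with
   [beta < 1]. *)
have := hd p y; rewrite fixp fixy (gmetric_eq0 hG (erefl y) (erefl y)) !mul0r mulr0 add0r.
move=> hpy; rewrite -(pmulr_rle0 _ (_ : 0 < 1 - beta)); lra.
Qed.
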